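(* Let $N\ge 1$ and let $a,b,c,d,\theta_1,\theta_2$ satisfy $$0<a,b,c,d,\theta_1,\theta_2<1,\qquad \theta_1<\theta_2,\qquad b+d<1.$$ Define $$(q,\alpha,\beta,\gamma,\delta)=\left(\frac{\theta_1}{\theta_2},\ \frac{(1-\theta_1)a}{\theta_2},\ \frac{(1-\theta_2)b}{\theta_2(1-b-d)},\ \frac{(1-\theta_2)c}{\theta_2},\ \frac{(1-\theta_1)d}{\theta_2(1-b-d)}\right),$$ and assume $ab/(cd)\notin\{q^l: l=0,1,2,\dots\}$. Let $\mu(\tau_1,\dots,\tau_N)$ be the (unique) stationary measure of the six-vertex model on the strip of width $N$ with parameters $(a,b,c,d,\theta_1,\theta_2)$ on a horizontal path, and let $\pi(\tau_1,\dots,\tau_N)$ be the (unique) stationary measure of the open ASEP on $\{1,\dots,N\}$ with jump rates $(q,\alpha,\beta,\gamma,\delta)$. Then, with $r=\frac{1-\theta_2}{1-\theta_1}\in(0,1)$ and some normalizing constant $Z$, $$\mu(\tau_1,\dots,\tau_N)=\frac{r^{\sum_{i=1}^N\tau_i}\,\pi(\tau_1,\dots,\tau_N)}{Z}\qquad\text{for all }\tau_1,\dots,\tau_N\in\{0,1\}.$$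
   Context: Strip and paths. Fix an integer $N\ge 1$. The strip of width $N$ is $\{(x,y)\in\mathbb Z^2: 0\le y\le x\le y+N\}$, with an edge between any two of its vertices at distance 1; each edge can carry at most one (up or right) arrow. Vertices $(y,y)$ are left boundary vertices, $(y+N,y)$ are right boundary vertices, all others are bulk vertices. The left/bottom edges at a vertex (those lying in the strip) are its incoming edges, the right/top ones its outgoing edges. Thus a left boundary vertex has at most a bottom incoming edge and a right outgoing edge; a right boundary vertex has a left incoming edge and a top outgoing edge. A down-right path $\mathcal P$ is a path in the strip from a left boundary vertex to a right boundary vertex with each step going down or right by 1 (so it has $N$ steps). Its outgoing edges are the edges going up or right from a vertex of $\mathcal P$ to a vertex not on $\mathcal P$; there are exactly $N$, labelled $p_1,\dots,p_N$ from up-left to down-right ($p_i$ is the unique one joining the lines $x-y=i-1$ and $x-y=i$). An outgoing configuration of $\mathcal P$ is $\tau=(\tau_1,\dots,\tau_N)\in\{0,1\}^N$, $\tau_i=1$ iff $p_i$ carries an arrow. A path is horizontal if it is $(y,y),(y+1,y),\dots,(y+N,y)$. Six-vertex dynamics. Let $\mathcal Q$ be a down-right path lying (weakly) above $\mathcal P$. Given an outgoing configuration of $\mathcal P$, sample sequentially the outgoing edges of all vertices between $\mathcal P$ and $\mathcal Q$, including those on $\mathcal Q$ and excluding those on $\mathcal P$, in order of increasing $y$ and, for equal $y$, increasing $x$, independently given the incoming edges, as follows. Bulk vertex: if both (resp. neither) incoming edges carry arrows, both (resp. neither) outgoing edges do; if only the left incoming edge carries an arrow, it exits to the right with probability $\theta_2$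 and to the top with probability $1-\theta_2$; if only the bottom incoming edge carries an arrow, it exits to the top with probability $\theta_1$ and to the right with probability $1-\theta_1$. Left boundary vertex: if the bottom edge carries an arrow, the right edge carries one with probability $1-c$ (none with probability $c$); if the bottom edge is empty, the right edge carries an arrow with probability $a$ (none with probability $1-a$). Right boundary vertex: if the left edge carries an arrow, the top edge carries one with probability $1-b$ (none with probability $b$); if the left edge is empty, the top edge carries an arrow with probability $d$ (none with probability $1-d$). This defines a transition matrix $P_{\mathcal P,\mathcal Q}(\tau,\tau')$ from outgoing configurations of $\mathcal P$ to those of $\mathcal Q$. Particle system on $\mathcal P$. Let $\mathcal P_k=\mathcal P+(k,k)$. The interacting particle system of the six-vertex model on the strip on $\mathcal P$ is the time-homogeneous Markov chain on $\{0,1\}^N$ with transition matrix $P_{\mathcal P_k,\mathcal P_{k+1}}=P_{\mathcal P,\mathcal P_1}$. Its stationary measure is called the stationary measure of the six-vertex model on a strip on $\mathcal P$. For $a,b,c,d,\theta_1,\theta_2\in(0,1)$ this chain is irreducible, so the stationary measure is unique. Open ASEP with rates $(q,\alpha,\beta,\gamma,\delta)$: the continuous-time Markov process on $\{0,1\}^N$ (particles on sites $1,\dots,N$, at most one per site) in which each particle jumps to its right neighbour at rate $1$ and to its left neighbour at rate $q$ (jumps to occupied sites are suppressed); particles enter at site $1$ at rate $\alpha$ and at site $N$ at rate $\delta$ if that site is empty; a particle at site $1$ is removed at rate $\gamma$ and a particle at site $N$ is removed at rate $\beta$. *)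

(* Defs.v *)
From HB Require Import structures.
From mathcomp Require Import all_boot all_order all_algebra.
From mathcomp Require Import boolp classical_sets reals topology normedtype sequences.

Set Implicit Arguments.
Unset Strict Implicit.
Unset Printing Implicit Defensive.

Import Order.TTheory GRing.Theory Num.Theory.
Import numFieldNormedType.Exports.

Local Open Scope ring_scope.

Definition config (N : nat) : finType := {ffun 'I_N -> bool}.

Section Markov.
Variables (R : realType) (S : finType).

Definition probability_vector (mu : S -> R) : Prop :=
  (forall s, 0 <= mu s) /\ \sum_s mu s = 1.

Definition stationary (K : S -> S -> R) (mu : S -> R) : Prop :=
  probability_vector mu /\ forall s', \sum_s mu s * K s s' = mu s'.

(* The values [rate s s] are ignored. *)
Definition generator (rate : S -> S -> R) (s s' : S) : R :=
  if s == s' then - \sum_(u | u != s) rate s u else rate s s'.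

Fixpoint kernel_pow (L : S -> S -> R) (k : nat) (s s' : S) : R :=
  if k is k'.+1 then \sum_u kernel_pow L k' s u * L u s' else (s == s')%:R.

(* Transition probabilities at time t: the entries of exp (t L). *)
Definition semigroup (L : S -> S -> R) (t : R) (s s' : S) : R :=
  limn (series (fun k => t ^+ k / k`!%:R * kernel_pow L k s s')).

Definition ct_stationary (rate : S -> S -> R) (mu : S -> R) : Prop :=
  forall t : R, 0 <= t -> stationary (semigroup (generator rate) t) mu.

End Markov.

(* Lattice points (x, y).  The strip lies in the first quadrant, so natural
   number coordinates suffice. *)
Definition vertex : Type := (nat * nat)%type.

(* An edge is given by its lower-left endpoint and its direction. *)
Definition edge : Type := (vertex * bool)%type.
Definition right_edge (v : vertex) : edge := (v, false).
Definition top_edge (v : vertex) : edge := (v, true).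

(* Truncated predecessors are harmless here: vertices strictly above a
   down-right path have both coordinates positive. *)
Definition left_edge (v : vertex) : edge := right_edge (v.1.-1, v.2).
Definition bottom_edge (v : vertex) : edge := top_edge (v.1, v.2.-1).

Definition in_strip (N : nat) (v : vertex) : bool := (v.2 <= v.1 <= v.2 + N)%N.
Definition left_boundary (v : vertex) : bool := v.1 == v.2.
Definition right_boundary (N : nat) (v : vertex) : bool := v.1 == (v.2 + N)%N.

Definition right_step (u v : vertex) : bool := v == (u.1.+1, u.2).
Definition down_step (u v : vertex) : bool := u == (v.1, v.2.+1).

Definition down_right_path (N : nat) (P : seq vertex) : bool :=
  if P is u :: P' then
    [&& all (in_strip N) P, left_boundary u, right_boundary N (last u P')
      & path (fun v w => right_step v w || down_step v w) u P']
  else false.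

Definition horizontal_path (N y : nat) : seq vertex :=
  [seq (x, y) | x <- iota y N.+1].

Definition shift (k : nat) (P : seq vertex) : seq vertex :=
  [seq ((v.1 + k)%N, (v.2 + k)%N) | v <- P].

Lemma down_right_horizontal (N y : nat) :
  down_right_path N (horizontal_path N y).
Proof.
apply/and4P; split.
- apply/allP => v /mapP[x]; rewrite mem_iota addnS ltnS => /andP[le_yx le_xN] ->.
  by rewrite /in_strip le_yx.
- exact: eqxx.
- have last_iota n z : last z (iota z.+1 n) = (z + n)%N.
    by elim: n z => [|n IHn] z /=; rewrite ?addn0 // IHn addnS addSn.
  rewrite last_map /right_boundary; apply/eqP; exact: last_iota.
- rewrite path_map.
  have path_iota n z : path (relpre (fun x => (x, y))
      (fun v w => right_step v w || down_step v w)) z (iota z.+1 n).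
    by elim: n z => [|n IHn] z //=; rewrite IHn andbT /right_step eqxx.
  exact: path_iota.
Qed.

(* With the vertices of P numbered from 0, vertex i lies on the line x - y = i;
   [out_edge P i] is the outgoing edge of P joining x - y = i and x - y = i + 1,
   i.e., p_(i+1) when counting from 1. *)
Definition out_edge (P : seq vertex) (i : nat) : edge :=
  let u := nth (0, 0)%N P i in
  let v := nth (0, 0)%N P i.+1 in
  if right_step u v then top_edge v else right_edge u.

Definition arrows : Type := edge -> bool.

Definition init_arrows (N : nat) (P : seq vertex) (tau : config N) : arrows :=
  fun e => [exists i : 'I_N, tau i && (out_edge P i == e)].

Definition out_config (N : nat) (P : seq vertex) (w : arrows) : config N :=
  [ffun i : 'I_N => w (out_edge P i)].

Definition set_out (w : arrows) (v : vertex) (o : bool * bool) : arrows :=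
  fun e => if e == right_edge v then o.1
           else if e == top_edge v then o.2 else w e.

Definition strictly_above (P : seq vertex) (v : vertex) : bool :=
  has (fun u => (u.1 + v.2 == v.1 + u.2)%N && (u.2 < v.2)%N) P.

Definition weakly_below (Q : seq vertex) (v : vertex) : bool :=
  has (fun u => (u.1 + v.2 == v.1 + u.2)%N && (v.2 <= u.2)%N) Q.

(* The vertices between P (excluded) and Q (included), by increasing y and
   then increasing x. *)
Definition between (N : nat) (P Q : seq vertex) : seq vertex :=
  [seq v <- [seq (x, y) | y <- iota 0 (\max_(u <- Q) u.2).+1, x <- iota y N.+1]
     | strictly_above P v && weakly_below Q v].

Section SixVertex.
Variables (R : realType) (N : nat) (a b c d theta1 theta2 : R).

Definition bernoulli (p : R) (x : bool) : R := if x then p else 1 - p.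

(* Conditional probability of the outgoing pair o = (right, top) given the left
   and bottom incoming edges.  At a boundary vertex the incoming and outgoing
   edges that leave the strip are absent, so the corresponding entry of o is
   required to be [false]. *)
Definition vertex_weight (v : vertex) (left bottom : bool) (o : bool * bool) : R :=
  if left_boundary v then
    bernoulli (if bottom then 1 - c else a) o.1 * (~~ o.2)%:R
  else if right_boundary N v then
    (~~ o.1)%:R * bernoulli (if left then 1 - b else d) o.2
  else match left, bottom with
    | true, true => (o == (true, true))%:R
    | false, false => (o == (false, false))%:R
    | true, false => theta2 * (o == (true, false))%:R
                     + (1 - theta2) * (o == (false, true))%:R
    | false, true => theta1 * (o == (false, true))%:R
                     + (1 - theta1) * (o == (true, false))%:R
    end.

(* Probability of the event A after sequentially sampling the outgoing edges of
   the vertices in vs, starting from the arrows w. *)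
Fixpoint sample (vs : seq vertex) (w : arrows) (A : arrows -> bool) : R :=
  if vs is v :: vs' then
    \sum_(o : bool * bool)
      vertex_weight v (w (left_edge v)) (w (bottom_edge v)) o
      * sample vs' (set_out w v o) A
  else (A w)%:R.

Definition transition (P Q : seq vertex) (tau tau' : config N) : R :=
  sample (between N P Q) (init_arrows P tau) (fun w => out_config N Q w == tau').

Definition six_vertex_chain (P : seq vertex) : config N -> config N -> R :=
  transition P (shift 1 P).

End SixVertex.

Section OpenASEP.
Variables (R : realType) (N : nat) (q alpha beta gamma delta : R).

Definition set_site (tau : config N) (i : 'I_N) (x : bool) : config N :=
  [ffun k => if k == i then x else tau k].

Definition jump (tau : config N) (i j : 'I_N) : config N :=
  set_site (set_site tau i false) j true.

(* For N = 1 both boundary sums contribute at the same site. *)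
Definition asep_rate (tau tau' : config N) : R :=
  \sum_(i < N) \sum_(j < N | j == i.+1 :> nat)
     ([&& tau i, ~~ tau j & tau' == jump tau i j]%:R
      + q * [&& tau j, ~~ tau i & tau' == jump tau j i]%:R)
  + \sum_(i < N | i == 0 :> nat)
     (alpha * (~~ tau i && (tau' == set_site tau i true))%:R
      + gamma * (tau i && (tau' == set_site tau i false))%:R)
  + \sum_(i < N | i.+1 == N)
     (delta * (~~ tau i && (tau' == set_site tau i true))%:R
      + beta * (tau i && (tau' == set_site tau i false))%:R).

End OpenASEP.

(* Main.v *)
Require Import Defs.
From HB Require Import structures.
From mathcomp Require Import all_boot all_order all_algebra.
From mathcomp Require Import boolp classical_sets reals topology normedtype sequences.
From mathcomp Require Import exp ring lra zify.

Set Implicit Arguments.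
Unset Strict Implicit.
Unset Printing Implicit Defensive.

Import Order.TTheory GRing.Theory Num.Theory.
Import numFieldNormedType.Exports.

Local Open Scope ring_scope.

(** The two stationary measures are two readings of one matrix product.

    Let D and E be operators on a space M, acting on row vectors from the
    right, w a vector and phi a linear form with
      DE - q ED = D + E,  w (alpha E - gamma D) = w,
      (beta D - delta E) phi = phi,
    and give the word s_1 ... s_n the weight F(s) = w X_1 ... X_n phi, where X_i
    is D or E according to s_i ([asep_module], [mp_weight]).  It is classical
    that F is stationary for the open ASEP: the contribution of
    a bond to the balance equation is a difference of two signed weights of
    words with one letter removed, and these telescope between the boundaries
    ([asep_balance]).

    For the six-vertex model put the operators r D and E on vertical edges and
    r D + u, E - u on horizontal edges, with u = theta2 / (1 - theta1).  The
    bulk relation of the algebra is then exactly the rule by which a bulk vertex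
    exchanges a horizontal and a vertical operator ([bulk_exchange]), and the
    two boundary relations are the rules of the boundary vertices
    ([left_exchange], [right_exchange]); this is where the formulas for q,
    alpha, beta, gamma, delta and r come from.  Pulling a whole row of vertices
    through the product shows that r^|s| F(s) is invariant under one step of the
    six-vertex chain ([kernel_invariance]).

    The algebra is realized on polynomials: E is multiplication by 'X, the left
    relation prescribes 1 D, the bulk relation then forces D on all monomials,
    and the right relation determines phi recursively, because the elements that
    phi has to kill have every positive degree exactly once.  This last point is
    where ab/(cd) must avoid the powers of q ([asep_module_exists]).

    Nothing makes F positive, so both chains are handled through uniqueness of
    signed invariant vectors: such a vector vanishes as soon as it vanishes at
    the empty configuration, which every configuration reaches
    ([signed_invariant_eq0]).  Hence mu is proportional to r^|s| F and pi to F.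
    F is not identically zero on words of length n, since the left relation
    expresses the weights of shorter words through those of longer ones and
    F is 1 on the empty word ([mp_nonzero]).  On the continuous-time side,
    invariance under the semigroup is turned into pi L = 0 by differentiating
    at time zero ([semigroup_invariant_balance]). *)

(** * Signed vectors balanced for a Markov chain *)

Lemma balance_generator (R : realType) (S : finType) (rate : S -> S -> R)
    (h : S -> R) (s' : S) :
  \sum_s h s * generator rate s s'
    = \sum_s (h s * rate s s' - h s' * rate s' s).
Proof.
rewrite (bigD1 s') //= [RHS](bigD1 s') //= subrr add0r /generator eqxx sumrB.
rewrite addrC mulrN -mulr_sumr; congr (_ - _).
by apply: eq_bigr => s /negbTE ->.
Qed.

Section SignedInvariant.
Variables (R : realDomainType) (S : finType) (G : S -> S -> R).
Hypothesis G_offdiag : forall s s', s != s' -> 0 <= G s s'.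
Hypothesis G_rowsum : forall s, \sum_s' G s s' = 0.

(** The triangle inequality gives [0 <= \sum_s `|h s| * G s s'] for each s', and
    the total over s' is zero since the rows of G sum to zero. *)
Lemma abs_balance (h : S -> R) :
  (forall s', \sum_s h s * G s s' = 0) ->
  forall s', \sum_s `|h s| * G s s' = 0.
Proof.
move=> hG.
have sub s' : 0 <= \sum_s `|h s| * G s s'.
  rewrite (bigD1 s') //= -lerBlDl sub0r.
  have /eqP := hG s'; rewrite (bigD1 s') //= addrC addr_eq0 => /eqP off.
  apply: (@le_trans _ _ `|\sum_(s | s != s') h s * G s s'|).
    rewrite off normrN normrM -mulrN ler_wpM2l //.
    by rewrite -normrN ler_norm.
  apply: le_trans (ler_norm_sum _ _ _) _; apply: ler_sum => s ss'.
  by rewrite normrM (ger0_norm (G_offdiag ss')).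
move=> s'.
have total : \sum_s' \sum_s `|h s| * G s s' = 0.
  rewrite exchange_big big1 // => s _; by rewrite -mulr_sumr G_rowsum mulr0.
by have /psumr_eq0P -> := total.
Qed.

(** For the vector of absolute values, being positive at s forces being positive
    at every s' with [G s s' > 0]; following transitions that decrease m, the
    support would reach s0. *)
Lemma signed_invariant_eq0 (s0 : S) (m : S -> nat) (h : S -> R) :
  (forall s, s != s0 -> exists2 s', G s s' > 0 & (m s' < m s)%N) ->
  (forall s', \sum_s h s * G s s' = 0) ->
  h s0 = 0 -> forall s, h s = 0.
Proof.
move=> reach /abs_balance hG h0 s; move: {2}(m s) (leqnn (m s)) => n.
elim: n s => [|n IHn] s.
all: have [->//|/reach[s' Gss' lt_m]] := eqVneq s s0.
all: move=> le_m; have := leq_trans lt_m le_m => //.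
move=> /IHn hs'0.
have /eqP := hG s'; rewrite (bigD1 s') //= hs'0 normr0 mul0r add0r.
move=> /eqP sum0.
have [->|ss'] := eqVneq s s'; first exact: hs'0.
have /psumr_eq0P/(_ sum0 s ss')/eqP :
    forall u, u != s' -> 0 <= `|h u| * G u s'.
  by move=> u us'; rewrite mulr_ge0 // G_offdiag.
by rewrite mulf_eq0 normr_eq0 (gt_eqF Gss') orbF => /eqP.
Qed.
End SignedInvariant.

Lemma balanced_proportional (R : comNzRingType) (S : finType) (G : S -> S -> R)
    (s0 : S) (f g : S -> R) :
  (forall h : S -> R, (forall s', \sum_s h s * G s s' = 0) -> h s0 = 0 ->
     forall s, h s = 0) ->
  (forall s', \sum_s f s * G s s' = 0) ->
  (forall s', \sum_s g s * G s s' = 0) ->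
  forall s, f s * g s0 = g s * f s0.
Proof.
move=> G_eq0 fG gG s; apply/eqP; rewrite -subr_eq0; apply/eqP.
apply: (G_eq0 (fun s => f s * g s0 - g s * f s0)) => [s'|].
  under eq_bigr => u _ do rewrite mulrBl (mulrAC (f u)) (mulrAC (g u)).
  by rewrite sumrB -!mulr_suml fG gG !mul0r subrr.
by rewrite mulrC subrr.
Qed.

Lemma invariant_balanced (R : nzRingType) (S : finType) (K : S -> S -> R)
    (h : S -> R) :
  (forall s', \sum_s h s * K s s' = h s') ->
  forall s', \sum_s h s * (K s s' - (s == s')%:R) = 0.
Proof.
move=> hK s'; under eq_bigr => s _ do rewrite mulrBr.
rewrite sumrB hK [X in _ - X](bigD1 s') //= eqxx mulr1 big1 ?addr0 ?subrr //.
by move=> s /negbTE ->; rewrite mulr0.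
Qed.

(** * Differentiating the semigroup at time zero *)

Section PowerSeries.
Local Open Scope classical_set_scope.
Local Open Scope ring_scope.
Variables (R : realType) (A M : R) (c : nat -> R).
Hypotheses (M0 : 0 <= M) (cle : forall k, `|c k| <= A * M ^+ k).

Lemma growth_bound_ge0 : 0 <= A.
Proof.
have := cle 0; rewrite expr0 mulr1; exact: le_trans (normr_ge0 (c 0)).
Qed.

Lemma power_term_bound (t : R) (k : nat) : 0 <= t ->
  `|t ^+ k / k`!%:R * c k| <= A * exp_coeff (t * M) k.
Proof.
move=> t0; have w0 : 0 <= t ^+ k / k`!%:R.
  by rewrite mulr_ge0 ?exprn_ge0 ?invr_ge0.
rewrite normrM ger0_norm //; apply: le_trans (ler_wpM2l w0 (cle k)) _.
rewrite le_eqVlt; apply/orP; left; apply/eqP.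
by rewrite /exp_coeff /= exprMn; ring.
Qed.

Lemma is_cvg_power_series (t : R) : 0 <= t ->
  cvgn (series (fun k => t ^+ k / k`!%:R * c k)).
Proof.
move=> t0; apply: normed_cvg.
have cvgA : cvgn (series (fun n => A * exp_coeff (t * M) n)).
  have := @is_cvg_seriesZ R (exp_coeff (t * M)) A (is_cvg_series_exp_coeff _).
  exact.
apply: (series_le_cvg _ _ _ cvgA) => n /=; first by [].
  by rewrite !mulr_ge0 ?exprn_ge0 ?invr_ge0 // ?growth_bound_ge0 // mulr_ge0.
exact: power_term_bound.
Qed.

(** On [0, 1] the tail of order two is at most t^2 B, so [t * `|c 1|] is at most
    t^2 B when the sum stays equal to its constant term; divide by t and let
    t tend to 0. *)
Lemma power_series_const :
  (forall t, 0 <= t ->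
     limn (series (fun k => t ^+ k / k`!%:R * c k)) = c 0%N) ->
  c 1%N = 0.
Proof.
move=> H; have A0 := growth_bound_ge0.
have exp0 i : 0 <= exp_coeff M i by rewrite mulr_ge0 ?exprn_ge0 ?invr_ge0.
set B := A * expR M.
have B0 : 0 <= B by rewrite mulr_ge0 ?expR_ge0.
have small t : 0 < t <= 1 -> `|c 1%N| <= t * B.
  move=> /andP[t0 t1]; pose u k := t ^+ k / k`!%:R * c k.
  have tail n : `|series u n.+2 - (c 0%N + t * c 1%N)| <= t ^+ 2 * B.
    rewrite /series /= big_nat_recl // big_nat_recl // addrA.
    rewrite /u expr0 expr1 (_ : 1`! = 1%N) // fact0 !divr1 mul1r.
    set S := \sum_(_ <= _ < _) _; rewrite [X in `|X|](_ : _ = S); last by ring.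
    apply: le_trans (ler_norm_sum _ _ _) _.
    apply: (@le_trans _ _ (t ^+ 2 * (A * series (exp_coeff M) n.+2))).
      rewrite /series /= [X in _ * (_ * X)]big_nat_recl // big_nat_recl //.
      rewrite !mulrDr !mulr_sumr -[leLHS]add0r lerD //;
        last rewrite -[leLHS]add0r lerD //.
      - exact: mulr_ge0 (exprn_ge0 2 (ltW t0)) (mulr_ge0 A0 (exp0 _)).
      - exact: mulr_ge0 (exprn_ge0 2 (ltW t0)) (mulr_ge0 A0 (exp0 _)).
      apply: ler_sum => k _; apply: le_trans (power_term_bound _ (ltW t0)) _.
      rewrite [leRHS]mulrCA ler_wpM2l //.
      have -> : exp_coeff (t * M) k.+2 = t ^+ k.+2 * exp_coeff M k.+2.
        by rewrite /exp_coeff /= exprMn -!mulrA.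
      rewrite ler_wpM2r // -addn2 exprD.
      by rewrite ler_piMl ?exprn_ge0 ?exprn_ile1 ?(ltW t0).
    apply: ler_wpM2l; first exact: exprn_ge0 (ltW t0).
    apply: ler_wpM2l => //.
    apply: nondecreasing_cvgn_le; last exact: is_cvg_series_exp_coeff.
    by apply: nondecreasing_series => i _ _.
  have cvu : series u n @[n --> \oo] --> c 0%N.
    rewrite -(H t (ltW t0)); exact: is_cvg_power_series (ltW t0).
  have : `|c 0%N - (c 0%N + t * c 1%N)| <= t ^+ 2 * B.
    have cvd : `|series u n - (c 0%N + t * c 1%N)| @[n --> \oo]
        --> `|c 0%N - (c 0%N + t * c 1%N)|.
      by apply: cvg_norm; apply: cvgB => //; exact: cvg_cst.
    rewrite -(cvg_lim _ cvd) //; apply: limr_le.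
      by apply/cvg_ex; eexists; exact: cvd.
    near=> n; have n2 : (2 <= n)%N by near: n; exists 2%N.
    by rewrite -(subnK n2) addn2; exact: tail.
  rewrite opprD addrA subrr sub0r normrN normrM (gtr0_norm t0).
  by rewrite expr2 -mulrA ler_pM2l.
apply/eqP; rewrite -normr_eq0 eq_le normr_ge0 andbT.
apply/ler_addgt0Pr => e e0; rewrite add0r.
(* B itself may be zero *)
have B1 : 0 < B + 1 by rewrite ltr_wpDl.
have s0 : 0 < Num.min 1 (e / (B + 1)) by rewrite lt_min ltr01 divr_gt0.
apply: le_trans (small (Num.min 1 (e / (B + 1))) _) _.
  by rewrite s0 ge_min lexx.
apply: (@le_trans _ _ (e / (B + 1) * B)).
  by rewrite ler_wpM2r // ge_min lexx orbT.
rewrite -mulrA ler_piMr ?ltW // mulrC ltr_pdivrMr // mul1r ltrDl //.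
Unshelve. all: by end_near. Qed.
End PowerSeries.

Section Semigroup.
Variables (R : realType) (S : finType) (L : S -> S -> R).

Lemma kernel_pow_bound (k : nat) (s s' : S) :
  `|kernel_pow L k s s'| <= (\sum_u \sum_v `|L u v|) ^+ k.
Proof.
set M := \sum_u _.
have M0 : 0 <= M by apply: sumr_ge0 => u _; apply: sumr_ge0.
elim: k s s' => [|k IHk] s s' /=.
  by case: eqP => _ /=; rewrite ?normr1 ?normr0.
apply: le_trans (ler_norm_sum _ _ _) _.
apply: (@le_trans _ _ (\sum_u M ^+ k * `|L u s'|)).
  by apply: ler_sum => u _; rewrite normrM ler_wpM2r.
rewrite -mulr_sumr exprSr ler_wpM2l ?exprn_ge0 //.
by apply: ler_sum => u _; rewrite (bigD1 s') //= lerDl sumr_ge0.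
Qed.

Lemma semigroup_invariant_balance (h : S -> R) :
  (forall t s', 0 <= t -> \sum_s h s * semigroup L t s s' = h s') ->
  forall s', \sum_s h s * L s s' = 0.
Proof.
move=> hP s'; set M := \sum_u \sum_v `|L u v|.
have M0 : 0 <= M by apply: sumr_ge0 => u _; apply: sumr_ge0.
pose c k := \sum_s h s * kernel_pow L k s s'.
have c0 : c 0%N = h s'.
  rewrite /c (bigD1 s') //= eqxx mulr1 big1 ?addr0 // => s /negbTE ->.
  by rewrite mulr0.
have -> : \sum_s h s * L s s' = c 1%N.
  apply: eq_bigr => s _ /=; congr (_ * _); rewrite (bigD1 s) //= eqxx mul1r.
  by rewrite big1 ?addr0 // => u; rewrite eq_sym => /negbTE ->; rewrite mul0r.
apply: (@power_series_const _ (\sum_s `|h s|) M) => // [k|t t0].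
  apply: le_trans (ler_norm_sum _ _ _) _.
  rewrite mulr_suml; apply: ler_sum => s _.
  by rewrite normrM ler_wpM2l // kernel_pow_bound.
rewrite c0 -(hP t s' t0).
have -> : series (fun k => t ^+ k / k`!%:R * c k) =
    (fun n => \sum_s h s
       * series (fun k => t ^+ k / k`!%:R * kernel_pow L k s s') n).
  apply/funext => n; rewrite /series /=.
  rewrite (eq_bigr _ (fun k _ => mulr_sumr _ _ _ _)).
  rewrite exchange_big; apply: eq_bigr => s _; rewrite mulr_sumr.
  by apply: eq_bigr => k _; ring.
apply/cvg_lim => //; apply: cvg_big => // [|s _]; first exact: add_continuous.
apply: cvgMl_tmp.
apply: (@is_cvg_power_series _ 1 M) => // k.
by rewrite mul1r; exact: kernel_pow_bound.
Qed.
End Semigroup.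

(** * Configurations as words *)

Section Words.
Variable N : nat.

Definition word (tau : config N) : seq bool := [seq tau i | i <- enum 'I_N].

Lemma size_word (tau : config N) : size (word tau) = N.
Proof. by rewrite size_map size_enum_ord. Qed.

Lemma nth_word (tau : config N) (i : 'I_N) : nth false (word tau) i = tau i.
Proof.
by rewrite (nth_map i) ?nth_ord_enum // size_enum_ord.
Qed.

Lemma eq_word (tau eta : config N) : (word tau == word eta) = (tau == eta).
Proof.
apply/eqP/eqP => [eq_w|-> //]; apply/ffunP => i.
by rewrite -!nth_word eq_w.
Qed.

Lemma word_mkseq (f : nat -> bool) : word [ffun i : 'I_N => f i] = mkseq f N.
Proof.
apply: (@eq_from_nth _ false); rewrite size_word ?size_mkseq // => i ltiN.
by rewrite -[i]/(val (Ordinal ltiN)) nth_word ffunE nth_mkseq.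
Qed.
End Words.

(** An explicit list, so that sums over configurations of size n.+1 unfold on the
    first letter. *)
Fixpoint words (n : nat) : seq (seq bool) :=
  if n is n'.+1 then
    [seq false :: s | s <- words n'] ++ [seq true :: s | s <- words n']
  else [:: [::]].

Lemma mem_words n s : (s \in words n) = (size s == n).
Proof.
elim: n s => [|n IHn] [|b s] //=; rewrite mem_cat.
  by apply/negP => /orP[] /mapP[].
rewrite eqSS -IHn; case: b.
  by rewrite orbC mem_map ?orb_idr //; [case/mapP|move=> ? ? []].
by rewrite mem_map ?orb_idr //; [case/mapP|move=> ? ? []].
Qed.

Lemma uniq_words n : uniq (words n).
Proof.
elim: n => //= n IHn; rewrite cat_uniq !map_inj_uniq ?IHn /= ?andbT;
  try by move=> ? ? [].
by apply/hasPn => _ /mapP[s _ ->]; apply/mapP => -[].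
Qed.

Lemma sum_config (R : nmodType) (N : nat) (F : seq bool -> R) :
  \sum_(tau : config N) F (word tau) = \sum_(s <- words N) F s.
Proof.
rewrite -(big_map (@word N) xpredT F); apply: perm_big.
have inj_word : injective (@word N) by move=> t e /eqP; rewrite eq_word => /eqP.
apply: uniq_perm; rewrite ?uniq_words ?map_inj_uniq ?index_enum_uniq //.
move=> s; rewrite mem_words; apply/mapP/eqP => [[tau _ ->]|size_s].
  exact: size_word.
exists [ffun i : 'I_N => nth false s i]; rewrite ?mem_index_enum //.
by rewrite word_mkseq -size_s mkseq_nth.
Qed.

Lemma big_words (R : nmodType) (n : nat) (F : seq bool -> R) :
  \sum_(s <- words n.+1) F s = \sum_(b : bool) \sum_(s <- words n) F (b :: s).
Proof. by rewrite /= big_cat !big_map big_bool; exact: addrC. Qed.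

Definition empty_config (N : nat) : config N := [ffun=> false].

Lemma word_empty_config N : word (empty_config N) = nseq N false.
Proof.
apply: (@eq_from_nth _ false); rewrite size_word ?size_nseq // => i iN.
by rewrite -[i]/(val (Ordinal iN)) nth_word ffunE nth_nseq iN.
Qed.

Lemma sum_config_count N (tau : config N) :
  (\sum_(i < N) tau i)%N = count id (word tau).
Proof.
rewrite -sum1_count big_map big_enum_cond [RHS]big_mkcond /=.
by apply: eq_bigr => i _; case: (tau i).
Qed.

Lemma config_of_word N (s : seq bool) : size s = N ->
  exists tau : config N, word tau = s.
Proof.
move=> szs; exists [ffun i : 'I_N => nth false s i].
by rewrite word_mkseq -szs mkseq_nth.
Qed.

Section WordSurgery.
Variables (N : nat) (tau : config N).

Lemma word_set_site i x :
  word (set_site tau i x) = take i (word tau) ++ x :: drop i.+1 (word tau).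
Proof.
apply: (@eq_from_nth _ false).
  rewrite size_cat /= size_take size_drop !size_word ltn_ord.
  by have := ltn_ord i; lia.
move=> k; rewrite size_word => kN.
have tauk : tau (Ordinal kN) = nth false (word tau) k.
  by rewrite -(nth_word tau (Ordinal kN)).
rewrite -[k]/(val (Ordinal kN)) nth_word ffunE.
rewrite nth_cat size_take size_word ltn_ord.
rewrite -val_eqE /= tauk; case: ltngtP => [ki|ik|->].
- by rewrite nth_take.
- by rewrite -[(k - i)%N]prednK ?subn_gt0 // -subnS /= nth_drop subnKC.
- by rewrite subnn.
Qed.

Lemma word_split (i : 'I_N) :
  word tau = take i (word tau) ++ tau i :: drop i.+1 (word tau).
Proof.
by rewrite -[LHS](cat_take_drop i) (drop_nth false) ?size_word // nth_word.
Qed.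

Lemma word_split2 (i j : 'I_N) : j = i.+1 :> nat ->
  word tau = take i (word tau) ++ tau i :: tau j :: drop j.+1 (word tau).
Proof.
move=> ij; rewrite [LHS](word_split i) -ij; congr (_ ++ _ :: _).
by rewrite (drop_nth false) ?size_word // nth_word.
Qed.
End WordSurgery.

Lemma set_siteC N (tau : config N) i j x y : i != j ->
  set_site (set_site tau i x) j y = set_site (set_site tau j y) i x.
Proof.
move=> ij; apply/ffunP => k; rewrite !ffunE.
by case: eqP => [->|//]; rewrite eq_sym (negbTE ij).
Qed.

Lemma word_set_site2 N (tau : config N) (i j : 'I_N) x y : j = i.+1 :> nat ->
  word (set_site (set_site tau i x) j y)
  = take i (word tau) ++ x :: y :: drop j.+1 (word tau).
Proof.
move=> ij; have [iN jN] : (i < size (word tau))%N /\ (j < size (word tau))%N.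
  by rewrite size_word.
have szu : size (take i (word tau)) = i by rewrite size_takel // ltnW.
rewrite !word_set_site ij -!cat_rcons; congr (_ ++ _).
  by rewrite take_size_cat // size_rcons szu.
rewrite drop_cat size_rcons szu ltnNge leqnSn /= subSnn drop_drop.
by rewrite add1n.
Qed.

(** The sum of the positions of the particles, counted from 1.  It drops when a
    particle moves to the left or is removed, and either chain can make it drop
    until the configuration is empty. *)
Fixpoint moment (s : seq bool) : nat :=
  if s is b :: s' then (count id s + moment s')%N else 0%N.

Lemma moment_rcons_false s : moment (rcons s false) = moment s.
Proof. by elim: s => //= b s ->; rewrite -cats1 count_cat /= !addn0. Qed.

Lemma moment_cat_lt u s t :
  count id s = count id t -> (moment s < moment t)%N ->
  (moment (u ++ s) < moment (u ++ t))%N.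
Proof.
move=> eq_c lt_m; elim: u => [|b u IHu] //.
by rewrite /= !count_cat eq_c ltn_add2l.
Qed.

(** * The matrix algebra of the open ASEP *)

Section MatrixProduct.
Variables (R : comNzRingType) (M : lmodType R) (D E : {linear M -> M}).

(** A particle carries D, a hole carries E. *)
Definition letter (x : bool) : {linear M -> M} := if x then D else E.
(** Words act from the right: the first letter acts first, and the word true false
    is the product that algebraists write DE. *)
Definition act (s : seq bool) (p : M) : M := foldl (fun p x => letter x p) p s.

Lemma act_is_linear s : linear (act s).
Proof.
elim: s => // x s IHs k p p'.
rewrite -[act (x :: s)]/(act s \o letter x) /= linearD linearZ; exact: IHs.
Qed.
HB.instance Definition _ s :=
  GRing.isLinear.Build R M M _ (act s) (act_is_linear s).

Lemma act_cat s t p : act (s ++ t) p = act t (act s p).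
Proof. exact: foldl_cat. Qed.

Variables (q alpha beta gamma delta : R) (w : M) (phi : {linear M -> R^o}).

(** The relations DE - q ED = D + E, w (alpha E - gamma D) = w and
    (beta D - delta E) phi = phi, with the products read from left to right. *)
Record asep_module : Prop := AsepModule {
  asep_vac : phi w = 1;
  asep_bulk : forall p, E (D p) - q *: D (E p) = D p + E p;
  asep_left : alpha *: E w - gamma *: D w = w;
  asep_right : forall p, beta * phi (D p) - delta * phi (E p) = phi p }.

Definition mp_weight (s : seq bool) : R := phi (act s w).
End MatrixProduct.

Section Monomial.
Variables (R : nzRingType) (V : lmodType R) (g : nat -> V).

Definition poly_ext (p : {poly R}) : V := \sum_(i < size p) p`_i *: g i.

Lemma poly_extE n (p : {poly R}) : (size p <= n)%N ->
  poly_ext p = \sum_(i < n) p`_i *: g i.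
Proof.
move=> le_pn; rewrite /poly_ext (big_ord_widen n (fun i => p`_i *: g i)) //.
rewrite big_mkcond; apply: eq_bigr => i _.
by case: ltnP => // /(nth_default 0) ->; rewrite scale0r.
Qed.

Lemma poly_ext_is_linear : linear poly_ext.
Proof.
move=> k p s; set n := maxn (size p) (size s).
have le_ps : (size (k *: p + s)%R <= n)%N.
  apply: leq_trans (size_polyD _ _) _.
  by rewrite geq_max !leq_max leqnn orbT (leq_trans (size_scale_leq _ _)).
rewrite (poly_extE le_ps) (@poly_extE n p) ?leq_maxl //.
rewrite (@poly_extE n s) ?leq_maxr //.
rewrite scaler_sumr -big_split /=; apply: eq_bigr => i _.
by rewrite coefD coefZ scalerDl scalerA.
Qed.

HB.instance Definition _ :=
  GRing.isLinear.Build R {poly R} V _ poly_ext poly_ext_is_linear.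

Lemma poly_extXn k : poly_ext 'X^k = g k.
Proof.
rewrite (@poly_extE k.+1) ?size_polyXn // big_ord_recr /= coefXn eqxx scale1r.
by rewrite big1 ?add0r // => i _; rewrite coefXn (ltn_eqF (ltn_ord i)) scale0r.
Qed.
End Monomial.

Lemma monomial_ind (R : nzRingType) (P : {poly R} -> Prop) :
  (forall p s, P p -> P s -> P (p + s)) -> (forall k n, P (k *: 'X^n)) ->
  forall p, P p.
Proof.
move=> PD PX p; rewrite -[p]coefK poly_def; apply: big_ind => //.
by rewrite -(scale0r 'X^0).
Qed.

Section Triangular.
Variables (R : fieldType) (g : nat -> {poly R}).
Hypothesis size_g : forall k, size (g k) = k.+2.

(** The values on 1, 'X, ..., 'X^n of the linear form that is 1 on 1 and kills
    g 0, ..., g n.-1. *)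
Fixpoint form_values (n : nat) : seq R :=
  if n is n'.+1 then
    let s := form_values n' in
    rcons s (- (\sum_(i < n) (g n')`_i * s`_i) / (g n')`_n)
  else [:: 1].

Lemma size_form_values n : size (form_values n) = n.+1.
Proof. by elim: n => //= n IHn; rewrite size_rcons IHn. Qed.

Lemma nth_form_values m n : (n <= m)%N -> (form_values m)`_n = (form_values n)`_n.
Proof.
elim: m => [|m IHm]; first by rewrite leqn0 => /eqP ->.
rewrite leq_eqVlt => /orP[/eqP -> //|lt_nm].
by rewrite [in LHS]/= nth_rcons size_form_values lt_nm IHm.
Qed.

(** Since g k has degree k.+1, the condition phi (g k) = 0 determines the value of
    phi at 'X^k.+1 from the previous ones. *)
Lemma triangular_functional :
  exists phi : {linear {poly R} -> R^o},
    phi 1 = 1 /\ forall k, phi (g k) = 0.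
Proof.
exists (poly_ext (fun k => (form_values k)`_k : R^o)); split=> [|k].
  by have := poly_extXn (fun k => (form_values k)`_k : R^o) 0; rewrite expr0.
rewrite /= (@poly_extE _ _ _ k.+2) ?size_g // big_ord_recr /=.
rewrite nth_rcons size_form_values ltnn eqxx /GRing.scale /= mulrCA divff ?mulr1.
  apply/eqP; rewrite subr_eq0; apply/eqP/eq_bigr => i _.
  by rewrite (@nth_form_values k i) // -ltnS ltn_ord.
have : lead_coef (g k) != 0 by rewrite lead_coef_eq0 -size_poly_eq0 size_g.
by rewrite lead_coefE size_g.
Qed.
End Triangular.

Definition mulX (R : comNzRingType) (p : {poly R}) : {poly R} := p * 'X.
Lemma mulX_is_linear (R : comNzRingType) : linear (@mulX R).
Proof. by move=> k p s; rewrite /mulX mulrDl scalerAl. Qed.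
HB.instance Definition _ (R : comNzRingType) :=
  GRing.isLinear.Build R {poly R} {poly R} _ (@mulX R) (@mulX_is_linear R).

Section Representation.
Variables (R : fieldType) (q alpha beta gamma delta : R).
Hypotheses (q0 : q != 0) (gamma0 : gamma != 0).
Hypothesis nondeg : forall k, alpha * beta != gamma * delta * q ^+ k.

(** The images of the monomials under D, forced by 1 D = (alpha 'X - 1) / gamma
    and, as 'X^k.+1 = 'X^k E, by ED = (DE - D - E) / q. *)
Fixpoint D_monomial (k : nat) : {poly R} :=
  if k is k'.+1 then q^-1 *: (('X - 1) * D_monomial k' - 'X^(k'.+1))
  else gamma^-1 *: (alpha *: 'X - 1).

Lemma D_monomial_lead k : (size (D_monomial k) <= k.+2)%N /\
   (D_monomial k)`_k.+1 = alpha / gamma / q ^+ k.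
Proof.
elim: k => [|k [IHs IHc]] /=.
  split; last by rewrite !(coefE) /= subr0 divr1; ring.
  apply: leq_trans (size_scale_leq _ _) _; apply: leq_trans (size_polyD _ _) _.
  rewrite size_polyN size_poly1 geq_max andbT.
  by apply: leq_trans (size_scale_leq _ _) _; rewrite size_polyX.
split.
  apply: leq_trans (size_scale_leq _ _) _; apply: leq_trans (size_polyD _ _) _.
  rewrite size_polyN size_polyXn geq_max leqnSn andbT.
  apply: leq_trans (size_polyMleq _ _) _; rewrite -[1]/(1%:P) size_XsubC /=.
  by rewrite ltnS.
rewrite coefZ coefB mulrBl mul1r coefB coefXM /= IHc.
rewrite [(D_monomial k)`_k.+2]nth_default // coefXn.
rewrite -[k.+2 == _]/(k.+1 == k) (gtn_eqF (ltnSn k)) !subr0.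
by rewrite exprS invfM; ring.
Qed.

Theorem asep_module_exists :
  exists (D E : {linear {poly R} -> {poly R}}) (phi : {linear {poly R} -> R^o}),
    asep_module D E q alpha beta gamma delta 1 phi.
Proof.
pose D : {linear {poly R} -> {poly R}} := poly_ext D_monomial.
have DXn k : D 'X^k = D_monomial k by exact: poly_extXn.
pose g k := beta *: D_monomial k - delta *: 'X^(k.+1) - 'X^k.
have [|phi [phi1 phig]] := @triangular_functional R g.
  move=> k; have [le_s lead] := D_monomial_lead k.
  apply/eqP; rewrite eqn_leq; apply/andP; split.
    apply: leq_trans (size_polyD _ _) _.
    rewrite size_polyN size_polyXn geq_max leqnSn andbT.
    apply: leq_trans (size_polyD _ _) _; rewrite size_polyN geq_max.
    by rewrite !(leq_trans (size_scale_leq _ _)) // size_polyXn.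
  (* the coefficient of 'X^k.+1 is alpha beta / (gamma q^k) - delta *)
  rewrite ltnNge; apply/negP => /leq_sizeP/(_ k.+1 (leqnn _))/eqP.
  rewrite /g !coefB !coefZ lead !coefXn eqxx gtn_eqF // subr0 mulr1 subr_eq0.
  rewrite -(inj_eq (mulfI gamma0)) -(inj_eq (mulIf (expf_neq0 k q0))).
  apply/negP; move: (nondeg k); congr (~~ (_ == _)); field.
  by rewrite gamma0 expf_neq0.
have D1 : D 1 = gamma^-1 *: (alpha *: 'X - 1) by have := DXn 0; rewrite expr0.
have D_mulX p : D (p * 'X) = q^-1 *: (('X - 1) * D p - p * 'X).
  elim/monomial_ind: p => [p s Hp Hs|k n].
    by rewrite mulrDl !linearD Hp Hs /= -!mul_polyC; ring.
  by rewrite -scalerAl -exprSr !linearZ !DXn /= -!mul_polyC; ring.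
pose E : {linear {poly R} -> {poly R}} := @mulX R.
have EE p : E p = p * 'X by [].
exists D, E, phi; split => // [p||p]; rewrite !EE.
- by rewrite D_mulX scalerA divff // scale1r; ring.
- by rewrite mul1r D1 scalerA divff // scale1r; ring.
elim/monomial_ind: p => [p s|k n].
  by rewrite mulrDl !linearD /= => <- <-; ring.
rewrite -scalerAl -exprSr !linearZ DXn /= /GRing.scale /=.
have /eqP := phig n; rewrite /g !linearB !linearZ /= subr_eq0 => /eqP <-.
by rewrite /GRing.scale /=; ring.
Qed.
End Representation.

Section MatrixProductRelations.
Variables (R : comNzRingType) (M : lmodType R) (D E : {linear M -> M}).
Variables (q alpha beta gamma delta : R) (w : M) (phi : {linear M -> R^o}).
Hypothesis rep : asep_module D E q alpha beta gamma delta w phi.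
Local Notation F := (mp_weight D E w phi).
Local Notation act := (act D E).

Lemma mp_bulk u v :
  F (u ++ true :: false :: v) - q * F (u ++ false :: true :: v)
  = F (u ++ true :: v) + F (u ++ false :: v).
Proof.
rewrite /mp_weight !act_cat; set p := act u w.
have /(congr1 (fun p => phi (act v p))) := asep_bulk rep p.
by rewrite !linearB !linearD !linearZ.
Qed.

Lemma mp_left v : alpha * F (false :: v) - gamma * F (true :: v) = F v.
Proof.
have /(congr1 (fun p => phi (act v p))) := asep_left rep.
by rewrite !linearB !linearZ.
Qed.

Lemma mp_right u : beta * F (rcons u true) - delta * F (rcons u false) = F u.
Proof. by rewrite /mp_weight -!cats1 !act_cat; exact: asep_right rep _. Qed.

(** By [mp_left], if F vanishes on the words of length n.+1 then it vanishes on
    those of length n, and finally at the empty word, where it is 1. *)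
Lemma mp_nonzero n : ~ (forall s, size s = n -> F s = 0).
Proof.
elim: n => [F0|n IHn F0].
  have /eqP := F0 [::] erefl; rewrite /mp_weight /= (asep_vac rep).
  by rewrite oner_eq0.
by apply: IHn => s szs; rewrite -mp_left !F0 ?mulr0 ?subrr //= szs.
Qed.
End MatrixProductRelations.

(** * The open ASEP *)

Section AsepBalance.
Variables (R : realType) (q alpha beta gamma delta : R) (F : seq bool -> R).
Hypothesis F_bulk : forall u v,
  F (u ++ true :: false :: v) - q * F (u ++ false :: true :: v)
  = F (u ++ true :: v) + F (u ++ false :: v).
Hypothesis F_left : forall v,
  alpha * F (false :: v) - gamma * F (true :: v) = F v.
Hypothesis F_right : forall u,
  beta * F (rcons u true) - delta * F (rcons u false) = F u.

(** The hat variables of the matrix ansatz: one site carries the scalar 1 (hole)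
    or -1 (particle) in place of its operator. *)
Definition removal (s : seq bool) (k : nat) : R :=
  (-1) ^+ nth false s k * F (take k s ++ drop k.+1 s).

Lemma sum_delta (S : finType) (f : S -> R) (b : bool) (s0 : S) :
  \sum_s f s * (b && (s == s0))%:R = b%:R * f s0.
Proof.
rewrite (bigD1 s0) //= big1 => [|s /negbTE ne]; last first.
  by rewrite ne andbF mulr0.
by rewrite addr0 eqxx andbT mulrC.
Qed.

Lemma sum_delta1 (S : finType) (b : bool) (s0 : S) :
  \sum_s (b && (s == s0))%:R = b%:R :> R.
Proof.
rewrite -[RHS]mulr1 -(sum_delta (fun=> 1) b s0).
by apply: eq_bigr => s _; rewrite mul1r.
Qed.

Lemma set_site_id N (tau : config N) i x :
  (set_site tau i x == tau) = (tau i == x).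
Proof.
apply/eqP/eqP => [<-|tx]; first by rewrite ffunE eqxx.
by apply/ffunP => k; rewrite ffunE; case: eqP => // ->.
Qed.

Lemma set_site_swap N (s s' : config N) i x :
  ((s i == ~~ x) && (s' == set_site s i x))
  = ((s' i == x) && (s == set_site s' i (~~ x))).
Proof.
apply/andP/andP => -[/eqP sx /eqP ->]; rewrite ffunE eqxx eqxx; split=> //.
  apply/eqP/ffunP => k; rewrite !ffunE; case: eqP => // ->; exact: sx.
by apply/eqP/ffunP => k; rewrite !ffunE; case: eqP => // ->; exact: sx.
Qed.

(** Sums over the source of a transition collapse once the source is written as a
    function of the target. *)
Lemma jump_swap N (s s' : config N) i j : i != j ->
  [&& s i, ~~ s j & s' == jump s i j] = [&& s' j, ~~ s' i & s == jump s' j i].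
Proof.
move=> ij; have ji : j != i by rewrite eq_sym.
apply/and3P/and3P => -[si sj /eqP ->];
  rewrite /jump !ffunE !eqxx ?(negbTE ij) ?(negbTE ji).
  split=> //; apply/eqP/ffunP => k; rewrite !ffunE.
  by have [->|_] := eqVneq k i; [|have [->|//] := eqVneq k j; apply/negbTE].
split=> //; apply/eqP/ffunP => k; rewrite !ffunE.
by have [->|_] := eqVneq k j; [|have [->|//] := eqVneq k i; apply/negbTE].
Qed.

Definition bond_rate N (i j : 'I_N) (s s' : config N) : R :=
  [&& s i, ~~ s j & s' == jump s i j]%:R
  + q * [&& s j, ~~ s i & s' == jump s j i]%:R.

Definition site_rate N (k1 k0 : R) (i : 'I_N) (s s' : config N) : R :=
  k1 * (~~ s i && (s' == set_site s i true))%:R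
  + k0 * (s i && (s' == set_site s i false))%:R.

Lemma asep_rateE n (s t : config n.+1) : asep_rate q alpha beta gamma delta s t
  = \sum_(i < n.+1) \sum_(j < n.+1 | j == i.+1 :> nat) bond_rate i j s t
    + site_rate alpha gamma ord0 s t + site_rate delta beta ord_max s t.
Proof.
rewrite /asep_rate; congr (_ + _ + _); first by rewrite (big_pred1 ord0).
by rewrite (big_pred1 ord_max).
Qed.

(** One bond contributes a discrete gradient, by the bulk relation. *)
Lemma bond_balance N (i j : 'I_N) (s' : config N) : j = i.+1 :> nat ->
  \sum_s (F (word s) * bond_rate i j s s' - F (word s') * bond_rate i j s' s)
  = removal (word s') i - removal (word s') j.
Proof.
move=> ij; have ne : i != j.
  by apply/eqP => eij; move: ij; rewrite -eij => /n_Sn.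
have ne' : j != i by rewrite eq_sym.
rewrite sumrB -mulr_sumr /bond_rate.
under eq_bigr => s _ do
  rewrite (jump_swap s s' ne) (jump_swap s s' ne') !andbA mulrDr mulrCA.
rewrite big_split /= -mulr_sumr !sum_delta.
under [X in _ - F _ * X]eq_bigr => s _ do rewrite !andbA.
rewrite big_split /= -mulr_sumr !sum_delta1.
have szu : size (take i (word s')) = i.
  by rewrite size_takel // size_word ltnW.
rewrite /jump (set_siteC s' _ _ ne') !(word_set_site2 s' _ _ ij).
have := word_split2 s' ij.
move: (take i _) (drop j.+1 _) szu => u v szu ->.
rewrite /removal ij -szu.
have -> : nth false (u ++ s' i :: s' j :: v) (size u) = s' i.
  by rewrite nth_cat ltnn subnn.
have -> : nth false (u ++ s' i :: s' j :: v) (size u).+1 = s' j.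
  by rewrite nth_cat ltnNge leqnSn /= subSnn.
have -> : take (size u) (u ++ s' i :: s' j :: v) = u by rewrite take_size_cat.
have -> : take (size u).+1 (u ++ s' i :: s' j :: v) = rcons u (s' i).
  by rewrite -cat_rcons take_size_cat ?size_rcons.
have -> : drop (size u).+1 (u ++ s' i :: s' j :: v) = s' j :: v.
  by rewrite -cat_rcons drop_size_cat ?size_rcons.
have -> : drop (size u).+2 (u ++ s' i :: s' j :: v) = v.
  by rewrite -!cat_rcons drop_size_cat ?size_rcons.
rewrite cat_rcons; have /eqP := F_bulk u v; rewrite subr_eq => /eqP Fuv.
by case: (s' i); case: (s' j) => /=; rewrite ?Fuv; ring.
Qed.

Lemma site_balance N (k1 k0 : R) (i : 'I_N) (s' : config N) :
  \sum_s (F (word s) * site_rate k1 k0 i s s'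
          - F (word s') * site_rate k1 k0 i s' s)
  = - (-1) ^+ s' i * (k1 * F (word (set_site s' i false))
                      - k0 * F (word (set_site s' i true))).
Proof.
have swap1 (s : config N) :
    ~~ s i && (s' == set_site s i true) = s' i && (s == set_site s' i false).
  by have := set_site_swap s s' i true; rewrite eqbF_neg eqb_id.
have swap0 (s : config N) :
    s i && (s' == set_site s i false) = ~~ s' i && (s == set_site s' i true).
  by have := set_site_swap s s' i false; rewrite eqbF_neg eqb_id.
rewrite sumrB -mulr_sumr /site_rate.
under eq_bigr => s _ do rewrite swap1 swap0 mulrDr !(mulrCA (F _)).
rewrite !big_split /= -!mulr_sumr !sum_delta !sum_delta1.
case: (boolP (s' i)) => [si|/negbTE si] /=.
  have -> : set_site s' i true = s' by apply/eqP; rewrite set_site_id si.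
  by rewrite expr1; ring.
have -> : set_site s' i false = s' by apply/eqP; rewrite set_site_id si.
by rewrite expr0; ring.
Qed.

(** The bond terms telescope to [removal] at the first site minus [removal] at the
    last one, and the boundary relations supply the opposite terms. *)
Lemma asep_balance N (s' : config N) : (0 < N)%N ->
  \sum_s (F (word s) * asep_rate q alpha beta gamma delta s s'
         - F (word s') * asep_rate q alpha beta gamma delta s' s) = 0.
Proof.
case: N s' => // n s' _.
under eq_bigr => s _ do rewrite !asep_rateE.
rewrite (eq_bigr (fun s =>
   \sum_(i < n.+1) \sum_(j < n.+1 | j == i.+1 :> nat)
       (F (word s) * bond_rate i j s s' - F (word s') * bond_rate i j s' s)
   + (F (word s) * site_rate alpha gamma ord0 s s'
       - F (word s') * site_rate alpha gamma ord0 s' s)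
   + (F (word s) * site_rate delta beta ord_max s s'
      - F (word s') * site_rate delta beta ord_max s' s)));
  last first.
  move=> s _.
  under [X in _ = X + _ + _]eq_bigr => i _ do rewrite sumrB -!mulr_sumr.
  rewrite sumrB -!mulr_sumr; ring.
rewrite 2!big_split /= !site_balance exchange_big /=.
under eq_bigr => i _.
  rewrite exchange_big /=.
  under eq_bigr => j /eqP ij do rewrite (bond_balance _ ij) ij.
  over.
have left_end : alpha * F (word (set_site s' ord0 false))
    - gamma * F (word (set_site s' ord0 true)) = F (drop 1 (word s')).
  by rewrite !word_set_site take0 F_left.
have right_end : delta * F (word (set_site s' ord_max false))
    - beta * F (word (set_site s' ord_max true)) = - F (take n (word s')).
  rewrite !word_set_site /= drop_oversize ?size_word // !cats1.
  rewrite -(F_right (take n _)); ring.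
rewrite left_end right_end.
have -> : \sum_(i < n.+1) \sum_(j < n.+1 | j == i.+1 :> nat)
    (removal (word s') i - removal (word s') i.+1)
    = removal (word s') 0 - removal (word s') n.
  rewrite big_ord_recr /= [X in _ + X]big_pred0 ?addr0 => [|j]; last first.
    by rewrite ltn_eqF.
  rewrite -[RHS]opprB -telescope_sumr // -sumrN big_mkord.
  apply: eq_bigr => i _.
  by rewrite opprB (big_pred1 (lift ord0 i)).
rewrite /removal take0 (drop_oversize (n := n.+1)) ?size_word // cats0.
rewrite -(nth_word s' ord0) -(nth_word s' ord_max) /=; ring.
Qed.
End AsepBalance.

Section AsepReach.
Variables (R : realType) (q alpha beta gamma delta : R).
Hypotheses (q0 : 0 < q) (alpha0 : 0 < alpha) (beta0 : 0 < beta)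
  (gamma0 : 0 < gamma) (delta0 : 0 < delta).

Lemma bond_rate_ge0 N (i j : 'I_N) s t : 0 <= bond_rate q i j s t.
Proof. by rewrite addr_ge0 ?mulr_ge0 // ltW. Qed.

Lemma site_rate_ge0 N (k1 k0 : R) (i : 'I_N) s t :
  0 < k1 -> 0 < k0 -> 0 <= site_rate k1 k0 i s t.
Proof. by move=> k1_0 k0_0; rewrite addr_ge0 // mulr_ge0 // ltW. Qed.

Lemma bonds_rate_ge0 n (s t : config n.+1) :
  0 <= \sum_(i < n.+1) \sum_(j < n.+1 | j == i.+1 :> nat) bond_rate q i j s t.
Proof.
by apply: sumr_ge0 => i _; apply: sumr_ge0 => j _; exact: bond_rate_ge0.
Qed.

Lemma asep_rate_ge0 n (s t : config n.+1) :
  0 <= asep_rate q alpha beta gamma delta s t.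
Proof.
rewrite asep_rateE; apply: addr_ge0; last exact: site_rate_ge0.
by apply: addr_ge0; [exact: bonds_rate_ge0 | exact: site_rate_ge0].
Qed.

(** The leftmost particle can always jump to the left, or leave from site 1. *)
Lemma asep_reach n (tau : config n.+1) : tau != empty_config n.+1 ->
  exists2 tau', 0 < asep_rate q alpha beta gamma delta tau tau'
              & (moment (word tau') < moment (word tau))%N.
Proof.
move=> ne; have [i0 ti0] : exists i, tau i.
  apply/existsP; apply: contraNT ne; rewrite negb_exists => /forallP t0.
  by apply/eqP/ffunP => i; rewrite ffunE; apply/negbTE.
case: (arg_minnP (fun i : 'I_n.+1 => val i) ti0) => i ti min_i {i0 ti0}.
case: (unliftP ord0 i) => [k ik|i_0]; last first.
  exists (set_site tau i false).
    rewrite asep_rateE ltr_pwDl ?site_rate_ge0 // ltr_wpDl ?bonds_rate_ge0 //.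
    by rewrite /site_rate -i_0 ti eqxx mulr0 mulr1 add0r.
  rewrite word_set_site [X in (_ < moment X)%N](word_split tau i) ti i_0.
  rewrite take0 /=.
  by rewrite add0n add1n addSn.
pose j : 'I_n.+1 := widen_ord (leqnSn n) k.
have ij : i = j.+1 :> nat by rewrite ik.
have tj : ~~ tau j by apply/negP => /min_i /=; rewrite ij ltnn.
have ne_ij : i != j by apply/eqP => eij; move: ij; rewrite -eij => /n_Sn.
exists (jump tau i j).
  rewrite asep_rateE -addrA ltr_pwDl //; last first.
    by apply: addr_ge0; exact: site_rate_ge0.
  rewrite (bigD1 j) //= ltr_pwDl //; last first.
    by apply: sumr_ge0 => i' _; apply: sumr_ge0 => j' _; exact: bond_rate_ge0.
  rewrite (bigD1 i) ?ij //= ltr_pwDl //; last first.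
    by apply: sumr_ge0 => j' _; exact: bond_rate_ge0.
  by rewrite /bond_rate ti tj eqxx /= mulr1 ltr_wpDl.
rewrite /jump (set_siteC tau _ _ ne_ij) (word_set_site2 _ _ _ ij).
rewrite [X in (_ < moment X)%N](word_split2 tau ij) ti (negbTE tj).
by apply: moment_cat_lt => //=; lia.
Qed.
End AsepReach.

(** * The six-vertex model as a kernel on words *)

Lemma sum_bool (V : nmodType) (F : bool -> V) :
  \sum_(b : bool) F b = F true + F false.
Proof. by rewrite big_bool. Qed.

Section Row.
Variables (R : realType) (a b c d theta1 theta2 : R).

Definition left_weight (bottom right : bool) : R :=
  bernoulli (if bottom then 1 - c else a) right.

Definition right_weight (left top : bool) : R :=
  bernoulli (if left then 1 - b else d) top.

Definition bulk_weight (left bottom right top : bool) : R :=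
  match left, bottom with
  | true, true => ((right, top) == (true, true))%:R
  | false, false => ((right, top) == (false, false))%:R
  | true, false => theta2 * ((right, top) == (true, false))%:R
                     + (1 - theta2) * ((right, top) == (false, true))%:R
  | false, true => theta1 * ((right, top) == (false, true))%:R
                     + (1 - theta1) * ((right, top) == (true, false))%:R
  end.

(** The probability that a row, entered from the left by the arrow h and from below
    by the arrows s, emits the arrows t at the top; the last letter of t leaves
    the right boundary vertex, so t is one longer than s. *)
Fixpoint row_weight (h : bool) (s t : seq bool) : R :=
  match s, t with
  | [::], [:: t0] => right_weight h t0
  | s0 :: s', t0 :: t' =>
      \sum_(h' : bool) bulk_weight h s0 h' t0 * row_weight h' s' t'
  | _, _ => 0
  end.

Lemma row_weight_cons h s0 s t0 t : row_weight h (s0 :: s) (t0 :: t) =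
  \sum_(h' : bool) bulk_weight h s0 h' t0 * row_weight h' s t.
Proof. by []. Qed.

(** The first letter of s enters the left boundary vertex, which has no top edge. *)
Definition word_kernel (s t : seq bool) : R :=
  if s is s0 :: s' then \sum_(h : bool) left_weight s0 h * row_weight h s' t
  else 0.

Lemma sum_pair_bool (V : nmodType) (F : bool * bool -> V) :
  \sum_o F o = \sum_(h : bool) \sum_(k : bool) F (h, k).
Proof. by rewrite pair_big; apply: eq_bigr => -[]. Qed.

Lemma set_out_top_neq (w : arrows) v o u : u != v ->
  set_out w v o (top_edge u) = w (top_edge u).
Proof.
move=> uv; rewrite /set_out /top_edge /right_edge !xpair_eqE andbF.
by rewrite (negbTE uv).
Qed.
Lemma set_out_top (w : arrows) v o : set_out w v o (top_edge v) = o.2.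
Proof. by rewrite /set_out /top_edge /right_edge !xpair_eqE andbF !eqxx. Qed.
Lemma set_out_right (w : arrows) v o : set_out w v o (right_edge v) = o.1.
Proof. by rewrite /set_out eqxx. Qed.

Definition row_tops (y : nat) (xs : seq nat) (w : arrows) : seq bool :=
  [seq w (top_edge (x, y)) | x <- xs].

Lemma row_tops_set_out y xs w v o : v \notin [seq (x, y) | x <- xs] ->
  row_tops y xs (set_out w v o) = row_tops y xs w.
Proof.
move=> vxs; apply/eq_in_map => x x_xs; rewrite set_out_top_neq //.
by apply: contraNneq vxs => <-; apply: map_f.
Qed.

Lemma eq_sample N vs w (A B : arrows -> bool) : A =1 B ->
  sample N a b c d theta1 theta2 vs w A = sample N a b c d theta1 theta2 vs w B.
Proof.
move=> eqAB; elim: vs w => [|v vs IHvs] w /=; first by rewrite eqAB.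
by apply: eq_bigr => o _; rewrite IHvs.
Qed.

Lemma sample_cons N v vs w A :
  sample N a b c d theta1 theta2 (v :: vs) w A =
  \sum_o vertex_weight N a b c d theta1 theta2 v
         (w (left_edge v)) (w (bottom_edge v)) o
     * sample N a b c d theta1 theta2 vs (set_out w v o) A.
Proof. by []. Qed.

(** Sampling a row from its vertex with abscissa x on; zs are the abscissas already
    sampled, whose top edges have to agree with s. *)
Lemma sample_row N y m x (w : arrows) zs (s t : seq bool) :
  (y.+1 < x)%N -> (x + m = y.+1 + N)%N ->
  all (fun z => z < x)%N zs -> size s = size zs -> size t = m.+1 ->
  sample N a b c d theta1 theta2 [seq (z, y.+1) | z <- iota x m.+1] w
    (fun w => row_tops y.+1 (zs ++ iota x m.+1) w == s ++ t)
  = (row_tops y.+1 zs w == s)%:R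
    * row_weight (w (right_edge (x.-1, y.+1))) (row_tops y (iota x m) w) t.
Proof.
elim: m x w zs s t => [|m IHm] x w zs s [|t0 t] // yx xm zsx szs [szt].
  rewrite addn0 in xm; case: t szt => //= _.
  rewrite sum_pair_bool sum_bool [X in X + _]big1 ?add0r; last first.
    move=> k _; rewrite /vertex_weight /left_boundary /right_boundary /= xm eqxx.
    by rewrite -xm gtn_eqF ?mul0r.
  have wt k : vertex_weight N a b c d theta1 theta2 (x, y.+1)
      (w (left_edge (x, y.+1))) (w (bottom_edge (x, y.+1))) (false, k)
      = right_weight (w (right_edge (x.-1, y.+1))) k.
    rewrite /vertex_weight /left_boundary /right_boundary /= xm eqxx.
    by rewrite -xm gtn_eqF // mul1r.
  have tops k : row_tops y.+1 (zs ++ [:: x]) (set_out w (x, y.+1) (false, k))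
       = rcons (row_tops y.+1 zs w) k.
    rewrite /row_tops map_cat /= set_out_top cats1; congr rcons.
    apply: row_tops_set_out; apply/mapP => -[z /(allP zsx) zx [xz]].
    by rewrite xz ltnn in zx.
  rewrite (bigD1 t0) //= big1 ?addr0.
    by rewrite wt tops -cats1 eqseq_cat ?size_map // eqxx andbT mulrC.
  move=> k kt0; rewrite tops -cats1 eqseq_cat ?size_map // eqseq_cons.
  by rewrite (negbTE kt0) andbF mulr0.
have -> : [seq (z, y.+1) | z <- iota x m.+2]
  = (x, y.+1) :: [seq (z, y.+1) | z <- iota x.+1 m.+1] by [].
rewrite sample_cons sum_pair_bool.
have step h k : sample N a b c d theta1 theta2
      [seq (z, y.+1) | z <- iota x.+1 m.+1] (set_out w (x, y.+1) (h, k))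
      (fun w => row_tops y.+1 (zs ++ iota x m.+2) w == s ++ t0 :: t)
    = ((row_tops y.+1 zs w == s) && (k == t0))%:R
      * row_weight h (row_tops y (iota x.+1 m) w) t.
  have := IHm x.+1 (set_out w (x, y.+1) (h, k)) (rcons zs x) (rcons s t0) t.
  rewrite -[x.+1.-1]/x set_out_right !cat_rcons => -> //.
  - rewrite (@row_tops_set_out y); last first.
      by apply/mapP => -[z _ [_ /esym/n_Sn]].
    congr (_%:R * _); rewrite {1}/row_tops map_rcons set_out_top /=.
    rewrite eqseq_rcons; congr (nat_of_bool ((_ == s) && _)).
    apply: row_tops_set_out; apply/mapP => -[z /(allP zsx) zx [xz]].
    by rewrite xz ltnn in zx.
  - exact: ltnW.
  - by rewrite -xm addSnnS.
  - rewrite all_rcons ltnSn; apply: sub_all zsx => z; exact: ltnW.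
  - by rewrite !size_rcons szs.
have wt h k : vertex_weight N a b c d theta1 theta2 (x, y.+1)
      (w (left_edge (x, y.+1))) (w (bottom_edge (x, y.+1))) (h, k)
      = bulk_weight (w (right_edge (x.-1, y.+1))) (w (top_edge (x, y))) h k.
  rewrite /vertex_weight /left_boundary /right_boundary /= gtn_eqF //.
  by rewrite ltn_eqF // -xm addnS ltnS leq_addr.
rewrite [row_weight _ _ _]/= mulr_sumr; apply: eq_bigr => h _.
under eq_bigr => k _ do rewrite step wt.
rewrite (bigD1 t0) //= big1 ?addr0 => [|k /negbTE ->].
  by rewrite eqxx andbT mulrCA.
by rewrite andbF mul0r mulr0.
Qed.

Lemma shift_horizontal N y :
  Defs.shift 1 (horizontal_path N y) = horizontal_path N y.+1.
Proof.
rewrite /Defs.shift /horizontal_path -map_comp -[y.+1]add1n iotaDl -map_comp.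
by apply: eq_map => x /=; rewrite !addn1.
Qed.

Lemma max_horizontal N y : (\max_(u <- horizontal_path N y) u.2)%N = y.
Proof.
have max_const n z : (\max_(x <- iota z n.+1) y)%N = y.
  elim: n z => [|n IHn] z; first by rewrite /= big_seq1.
  by rewrite -[iota z n.+2]/(z :: iota z.+1 n.+1) big_cons IHn maxnn.
by rewrite big_map max_const.
Qed.

Lemma between_horizontal N y :
  between N (horizontal_path N y) (horizontal_path N y.+1)
  = [seq (x, y.+1) | x <- iota y.+1 N.+1].
Proof.
rewrite /between max_horizontal filter_flatten -map_comp.
set row := _ \o _.
rewrite -[y.+2]addn1 iotaD map_cat flatten_cat add0n.
have -> : flatten [seq row z | z <- iota y.+1 1] = row y.+1 by rewrite /= cats0.
rewrite (_ : flatten _ = [::]) ?cat0s.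
  apply/all_filterP/allP => v /mapP[x]; rewrite mem_iota => /andP[yx xN] ->.
  apply/andP; split; apply/hasP.
    exists (x.-1, y); last by rewrite /=; lia.
    by apply: map_f; rewrite mem_iota; lia.
  exists (x, y.+1); last by rewrite /=; lia.
  by apply: map_f; rewrite mem_iota; lia.
apply/nilP; rewrite /nilp size_flatten /shape -map_comp.
rewrite sumnE big_map big_seq big1 //.
move=> z; rewrite mem_iota add0n => /andP[_ zy] /=; apply/eqP.
rewrite size_filter -leqn0 leqNgt -has_count; apply/hasPn => _ /mapP[x _ ->].
apply/negP => /andP[/hasP[_ /mapP[x' _ ->]]] /=; lia.
Qed.

Lemma out_edge_horizontal N y i : (i < N)%N ->
  out_edge (horizontal_path N y) i = top_edge (y.+1 + i, y)%N.
Proof.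
move=> iN; rewrite /out_edge /horizontal_path !(nth_map 0%N) ?size_iota ?ltnS //;
  last by rewrite ltnW.
by rewrite !nth_iota ?ltnS ?iN ?(ltnW iN) // /right_step /= addnS eqxx.
Qed.

Lemma out_config_horizontal N y (w : arrows) :
  word (out_config N (horizontal_path N y) w) = row_tops y (iota y.+1 N) w.
Proof.
have -> : out_config N (horizontal_path N y) w
    = [ffun i : 'I_N => w (top_edge (y.+1 + i, y)%N)].
  by apply/ffunP => i; rewrite !ffunE out_edge_horizontal.
rewrite (word_mkseq N (fun i => w (top_edge (y.+1 + i, y)%N))).
rewrite /row_tops -[y.+1]addn0 iotaDl -map_comp /mkseq.
by apply: eq_map => i /=; rewrite addn0.
Qed.

Lemma init_arrows_horizontal N y (tau : config N) :
  row_tops y (iota y.+1 N) (init_arrows (horizontal_path N y) tau) = word tau.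
Proof.
apply: (@eq_from_nth _ false); rewrite size_map size_iota ?size_word // => i iN.
have -> : nth false (word tau) i = tau (Ordinal iN).
  exact: nth_word tau (Ordinal iN).
rewrite (nth_map 0%N) ?size_iota // nth_iota //.
apply/existsP/idP => [[j /andP[tj]]|ti].
  rewrite out_edge_horizontal // => /eqP[/addnI ji].
  by rewrite (_ : Ordinal iN = j) //; apply: val_inj.
by exists (Ordinal iN); rewrite ti out_edge_horizontal ?eqxx.
Qed.

(** Between two consecutive horizontal paths there is exactly one row of vertices,
    so a step of the chain depends on the configurations only through words. *)
Lemma six_vertex_chain_word N y (tau eta : config N) : (0 < N)%N ->
  six_vertex_chain a b c d theta1 theta2 (horizontal_path N y) tau eta
  = word_kernel (word tau) (word eta).
Proof.
case: N tau eta => // m tau eta _.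
rewrite /six_vertex_chain /transition shift_horizontal between_horizontal.
have -> : [seq (x, y.+1) | x <- iota y.+1 m.+2]
  = (y.+1, y.+1) :: [seq (x, y.+1) | x <- iota y.+2 m.+1] by [].
set w0 := init_arrows _ _; rewrite sample_cons sum_pair_bool.
have w0E : row_tops y (iota y.+1 m.+1) w0 = word tau.
  exact: init_arrows_horizontal.
rewrite -w0E [row_tops y _ _]/= [word_kernel _ _]/=; apply: eq_bigr => h _.
rewrite sum_bool.
have wt k : vertex_weight m.+1 a b c d theta1 theta2 (y.+1, y.+1)
      (w0 (left_edge (y.+1, y.+1))) (w0 (bottom_edge (y.+1, y.+1))) (h, k)
    = left_weight (w0 (top_edge (y.+1, y))) h * (~~ k)%:R.
  by rewrite /vertex_weight /left_boundary eqxx.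
rewrite !wt mulr0 mul0r add0r mulr1; congr (_ * _).
pose A (w : arrows) :=
  row_tops y.+1 ([::] ++ iota y.+2 m.+1) w == [::] ++ word eta.
rewrite (@eq_sample _ _ _ _ A); last first.
  by move=> w; rewrite -eq_word out_config_horizontal.
rewrite sample_row ?size_word //; last by rewrite addSnnS.
rewrite set_out_right mul1r (@row_tops_set_out y) //.
by apply/mapP => -[z _ [_ /esym/n_Sn]].
Qed.
End Row.

(** The outcome of a row without horizontal arrows: an arrow at the first site is
    absorbed at the left boundary, the others go straight up, and they move one
    site left because consecutive rows are shifted against each other. *)
Definition step_left (s : seq bool) : seq bool := rcons (behead s) false.

Lemma moment_step_left s : s != nseq (size s) false ->
  (moment (step_left s) < moment s)%N.
Proof.
case: s => // b s; rewrite /step_left moment_rcons_false => ne.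
rewrite -[X in (X < _)%N]add0n ltn_add2r -has_count; apply: contraNT ne.
by move=> /hasPn no1; apply/eqP/all_pred1P/allP => x /no1 /= /negbTE ->.
Qed.

Section Kernel.
Variables (R : realType) (a b c d theta1 theta2 : R).
Hypotheses (a0 : 0 < a) (a1 : a < 1) (b0 : 0 < b) (b1 : b < 1)
  (c0 : 0 < c) (c1 : c < 1) (d0 : 0 < d) (d1 : d < 1)
  (t10 : 0 < theta1) (t11 : theta1 < 1) (t20 : 0 < theta2) (t21 : theta2 < 1).

Local Notation left_weight := (left_weight a c).
Local Notation right_weight := (right_weight b d).
Local Notation bulk_weight := (bulk_weight theta1 theta2).
Local Notation row_weight := (row_weight b d theta1 theta2).
Local Notation word_kernel := (word_kernel a b c d theta1 theta2).

Lemma bernoulli_ge0 (p : R) x : 0 < p < 1 -> 0 <= bernoulli p x.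
Proof. by case: x => /=; lra. Qed.

Lemma left_weight_ge0 x y : 0 <= left_weight x y.
Proof.
by apply: bernoulli_ge0; case: x; rewrite /= ?a0 // subr_gt0 c1 gtrBl.
Qed.

Lemma right_weight_ge0 x y : 0 <= right_weight x y.
Proof.
by apply: bernoulli_ge0; case: x; rewrite /= ?d0 // subr_gt0 b1 gtrBl.
Qed.

Lemma bulk_weight_ge0 h k h' k' : 0 <= bulk_weight h k h' k'.
Proof.
move: t10 t11 t20 t21.
by case: h; case: k; case: h'; case: k';
  rewrite /bulk_weight ?xpair_eqE /=; lra.
Qed.

Lemma row_weight_ge0 h s t : 0 <= row_weight h s t.
Proof.
elim: s h t => [|s0 s IHs] h [|t0 t] //=.
  by case: t => // *; exact: right_weight_ge0.
by apply: sumr_ge0 => h' _; rewrite mulr_ge0 ?bulk_weight_ge0.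
Qed.

Lemma word_kernel_ge0 s t : 0 <= word_kernel s t.
Proof.
case: s => //= s0 s; apply: sumr_ge0 => h _.
by rewrite mulr_ge0 ?left_weight_ge0 ?row_weight_ge0.
Qed.

Lemma row_weight_sum h s : \sum_(t <- words (size s).+1) row_weight h s t = 1.
Proof.
elim: s h => [|s0 s IHs] h.
  rewrite big_words sum_bool /= !big_seq1 /right_weight /=; ring.
rewrite big_words /=.
under eq_bigr => t0 _.
  rewrite exchange_big; under eq_bigr => h' _ do rewrite -mulr_sumr IHs mulr1.
  over.
rewrite !sum_bool; case: h; case: s0 => /=; ring.
Qed.

Lemma word_kernel_sum s : (0 < size s)%N ->
  \sum_(t <- words (size s)) word_kernel s t = 1.
Proof.
case: s => // s0 s _; rewrite exchange_big.
under eq_bigr => h _ do rewrite -mulr_sumr row_weight_sum mulr1.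
by rewrite sum_bool /left_weight /=; ring.
Qed.

Lemma sum_bool_gt0 (f : bool -> R) x :
  (forall y, 0 <= f y) -> 0 < f x -> 0 < \sum_y f y.
Proof.
by move=> f0 fx; rewrite (bigD1 x) //= ltr_pwDl // sumr_ge0.
Qed.

Lemma row_weight_step_left s : 0 < row_weight false s (rcons s false).
Proof.
elim: s => [|s0 s IHs]; first by rewrite /= subr_gt0.
rewrite rcons_cons row_weight_cons.
apply: (@sum_bool_gt0 _ false) => [h|].
  exact: mulr_ge0 (bulk_weight_ge0 _ _ _ _) (row_weight_ge0 _ _ _).
rewrite mulr_gt0 //; move: t10.
by case: s0 {IHs}; rewrite /bulk_weight ?xpair_eqE /=; lra.
Qed.

Lemma word_kernel_step_left s : (0 < size s)%N ->
  0 < word_kernel s (step_left s).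
Proof.
case: s => // s0 s _; apply: (@sum_bool_gt0 _ false) => [h|].
  by rewrite mulr_ge0 ?left_weight_ge0 ?row_weight_ge0.
rewrite mulr_gt0 ?row_weight_step_left //; move: a1 c0.
by case: s0; rewrite /left_weight /=; lra.
Qed.
End Kernel.

(** * Pulling a row of vertices through a matrix product *)

Section SixVertexInvariance.
Variables (R : realType) (a b c d theta1 theta2 : R).
Hypotheses (t1 : 1 - theta1 != 0) (t2 : theta2 != 0) (bd : 1 - b - d != 0).
Let q := theta1 / theta2.
Let alpha := (1 - theta1) * a / theta2.
Let beta := (1 - theta2) * b / (theta2 * (1 - b - d)).
Let gamma := (1 - theta2) * c / theta2.
Let delta := (1 - theta1) * d / (theta2 * (1 - b - d)).
Let r := (1 - theta2) / (1 - theta1).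
Let u := theta2 / (1 - theta1).
Variables (M : lmodType R) (D E : {linear M -> M}) (w : M).
Variable phi : {linear M -> R^o}.
Hypothesis rep : asep_module D E q alpha beta gamma delta w phi.
Local Notation F := (mp_weight D E w phi).
Local Notation act := (act D E).
Local Notation letter := (letter D E).
Local Notation left_weight := (left_weight a c).
Local Notation right_weight := (right_weight b d).
Local Notation bulk_weight := (bulk_weight theta1 theta2).
Local Notation row_weight := (row_weight b d theta1 theta2).
Local Notation word_kernel := (word_kernel a b c d theta1 theta2).

(** The operators on horizontal edges; their sum is r D + E, that of the vertical
    ones. *)
Definition horizontal_letter (h : bool) (p : M) : M :=
  if h then r *: D p + u *: p else E p - u *: p.

(** Composed with any linear form psi, the relation DE - q ED = D + E lets a
    horizontal operator pass a vertical one with the weights of a bulk vertex. *)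
Lemma bulk_exchange (psi : {linear M -> R^o}) (h' k' : bool) (p : M) :
  \sum_(h : bool) \sum_(k : bool)
      bulk_weight h k h' k' * (r ^+ k * psi (letter k (horizontal_letter h p)))
  = r ^+ k' * psi (horizontal_letter h' (letter k' p)).
Proof.
have /(congr1 psi) := asep_bulk rep p.
rewrite linearB linearZ linearD /= => /eqP; rewrite subr_eq => /eqP ED.
rewrite !sum_bool; case: h'; case: k';
  rewrite /bulk_weight /horizontal_letter /letter !xpair_eqE /=
    !(linearB, linearD, linearZ) /= ?expr0 ?expr1 ?ED /GRing.scale /= /q /r /u;
  by field; rewrite ?t1 ?t2.
Qed.

Lemma left_exchange (psi : {linear M -> R^o}) (h : bool) :
  \sum_(k : bool) left_weight k h * (r ^+ k * psi (letter k w)) 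
  = psi (horizontal_letter h w).
Proof.
have /(congr1 psi) := asep_left rep.
rewrite linearB !linearZ /= /GRing.scale /= => psiw.
rewrite sum_bool; case: h; rewrite /left_weight /horizontal_letter /letter /=
  !(linearB, linearD, linearZ) /= /GRing.scale /= -psiw ?expr0 ?expr1
  /alpha /gamma /r /u; by field; rewrite ?t1 ?t2.
Qed.

Lemma right_exchange (k : bool) (p : M) :
  \sum_(h : bool) right_weight h k * phi (horizontal_letter h p) 
  = r ^+ k * phi (letter k p).
Proof.
have phip := asep_right rep p.
rewrite sum_bool; case: k; rewrite /right_weight /horizontal_letter /letter /=
  !(linearB, linearD, linearZ) /= /GRing.scale /= -phip ?expr0 ?expr1
  /beta /delta /r /u; by field; rewrite ?t1 ?t2 ?bd.
Qed.

(** The horizontal operator entering from the left is carried through the product,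
    one vertex at a time, and is absorbed by phi at the right boundary. *)
Lemma row_invariance (t : seq bool) (m : nat) (p : M) : size t = m.+1 ->
  \sum_(s <- words m) \sum_(h : bool)
     r ^+ count id s * phi (act s (horizontal_letter h p)) * row_weight h s t
  = r ^+ count id t * phi (act t p).
Proof.
elim: m t p => [|m IHm] [|t0 t] p //= [szt].
  case: t szt => // _; rewrite big_seq1 /= addn0 -right_exchange.
  by apply: eq_bigr => h _; rewrite mul1r mulrC.
rewrite exprD -mulrA -IHm // big_words exchange_big mulr_sumr /=.
apply: eq_bigr => s _.
transitivity (\sum_(h' : bool) r ^+ count id s * row_weight h' s t *
  \sum_(h : bool) \sum_(k : bool) bulk_weight h k h' t0
     * (r ^+ k * phi (act s (letter k (horizontal_letter h p))))); last first.
  rewrite mulr_sumr; apply: eq_bigr => h' _.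
  have := bulk_exchange (phi \o act s) h' t0 p => /= ->; ring.
rewrite exchange_big.
under [RHS]eq_bigr => h' _ do rewrite mulr_sumr.
rewrite [RHS]exchange_big; apply: eq_bigr => h _.
under [RHS]eq_bigr => h' _ do rewrite mulr_sumr.
rewrite [RHS]exchange_big; apply: eq_bigr => k _.
rewrite mulr_sumr; apply: eq_bigr => h' _; rewrite exprD /=; ring.
Qed.

Lemma kernel_invariance (t : seq bool) : (0 < size t)%N ->
  \sum_(s <- words (size t)) r ^+ count id s * F s * word_kernel s t
  = r ^+ count id t * F t.
Proof.
move=> t0; have szt : size t = (size t).-1.+1 by rewrite prednK.
move: szt; move: (size t).-1 => m szt; rewrite szt.
rewrite /mp_weight -(row_invariance w szt) big_words exchange_big /=.
apply: eq_bigr => s _.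
transitivity (\sum_(h : bool) r ^+ count id s * row_weight h s t *
  \sum_(k : bool) left_weight k h
     * (r ^+ k * phi (act s (letter k w)))); last first.
  apply: eq_bigr => h _.
  have := left_exchange (phi \o act s) h => /= ->; ring.
under [RHS]eq_bigr => h _ do rewrite mulr_sumr.
rewrite [RHS]exchange_big; apply: eq_bigr => k _.
rewrite mulr_sumr; apply: eq_bigr => h _; rewrite exprD /=; ring.
Qed.
End SixVertexInvariance.

(** * Uniqueness and conclusion *)

Section Uniqueness.
Variables (R : realType) (N : nat).
Hypothesis N0 : (0 < N)%N.

Lemma asep_balanced_eq0 (q alpha beta gamma delta : R) :
  0 < q -> 0 < alpha -> 0 < beta -> 0 < gamma -> 0 < delta ->
  forall h : config N -> R,
  (forall s', \sum_s h s
     * generator (asep_rate q alpha beta gamma delta) s s' = 0) ->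
  h (empty_config N) = 0 -> forall s, h s = 0.
Proof.
case: N N0 => // n _ q0 al0 be0 ga0 de0 h.
apply: (@signed_invariant_eq0 _ _ _ _ _ _ (fun s => moment (word s))).
- move=> s s' ss'; rewrite /generator (negbTE ss'); exact: asep_rate_ge0.
- move=> s; rewrite (bigD1 s) //= /generator eqxx.
  rewrite [X in _ + X](eq_bigr (asep_rate q alpha beta gamma delta s));
    first by rewrite addNr.
  by move=> u us; rewrite eq_sym (negbTE us).
- move=> s /(asep_reach q0 al0 be0 ga0 de0)[s' rate_gt0 lt_m]; exists s' => //.
  by rewrite /generator; case: eqP lt_m => [->|//]; rewrite ltnn.
Qed.

Lemma six_vertex_balanced_eq0 (a b c d theta1 theta2 : R) y :
  0 < a < 1 -> 0 < b < 1 -> 0 < c < 1 -> 0 < d < 1 ->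
  0 < theta1 < 1 -> 0 < theta2 < 1 ->
  forall h : config N -> R,
  (forall s', \sum_s h s
     * (six_vertex_chain a b c d theta1 theta2 (horizontal_path N y) s s'
        - (s == s')%:R) = 0) ->
  h (empty_config N) = 0 -> forall s, h s = 0.
Proof.
move=> /andP[a0 a1] /andP[b0 b1] /andP[c0 c1] /andP[d0 d1].
move=> /andP[t10 t11] /andP[t20 t21].
pose K : config N -> config N -> R :=
  six_vertex_chain a b c d theta1 theta2 (horizontal_path N y).
have KE s s' : K s s' = word_kernel a b c d theta1 theta2 (word s) (word s').
  exact: six_vertex_chain_word.
move=> h; rewrite -/K.
apply: (@signed_invariant_eq0 _ _ (fun s s' => K s s' - (s == s')%:R)
  _ _ _ (fun s => moment (word s))).
- move=> s s' /negbTE ss'; rewrite ss' subr0 KE; exact: word_kernel_ge0.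
- move=> s; rewrite sumrB (eq_bigr _ (fun s' _ => KE s s')) sum_config.
  rewrite -[X in words X](size_word s) word_kernel_sum ?size_word //.
  rewrite (bigD1 s) //= eqxx big1 ?addr0 ?subrr // => s' ne.
  by rewrite eq_sym (negbTE ne).
- move=> s ne.
  have ne_word : word s != nseq (size (word s)) false.
    by rewrite size_word -word_empty_config eq_word.
  have lt_m := moment_step_left ne_word.
  have [|s' ws'] := @config_of_word N (step_left (word s)).
    by rewrite size_rcons size_behead size_word prednK.
  exists s'; last by rewrite ws'.
  have ss' : s != s'.
    by apply: contraTneq lt_m => eq_ss'; rewrite -ws' -eq_ss' ltnn.
  rewrite KE ws' (negbTE ss') subr0.
  by apply: word_kernel_step_left; rewrite ?size_word.
Qed.
End Uniqueness.

Theorem theorem1p1 (R : realType) (N : nat) (a b c d theta1 theta2 : R)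
    (y : nat) (mu pi : config N -> R) :
  (1 <= N)%N ->
  0 < a < 1 -> 0 < b < 1 -> 0 < c < 1 -> 0 < d < 1 ->
  0 < theta1 < 1 -> 0 < theta2 < 1 ->
  theta1 < theta2 -> b + d < 1 ->
  let q := theta1 / theta2 in
  let alpha := (1 - theta1) * a / theta2 in
  let beta := (1 - theta2) * b / (theta2 * (1 - b - d)) in
  let gamma := (1 - theta2) * c / theta2 in
  let delta := (1 - theta1) * d / (theta2 * (1 - b - d)) in
  (forall l : nat, a * b / (c * d) <> q ^+ l) ->
  stationary (six_vertex_chain a b c d theta1 theta2 (horizontal_path N y)) mu ->
  ct_stationary (asep_rate q alpha beta gamma delta) pi ->
  let r := (1 - theta2) / (1 - theta1) in
  0 < r < 1 /\
  exists Z : R, 0 < Z /\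
    forall tau : config N,
      mu tau = r ^+ (\sum_(i < N) tau i)%N * pi tau / Z.
Proof.
move=> N0 a01 b01 c01 d01 t101 t201 t12 bd q alpha beta gamma delta nondeg
  [[mu_ge0 mu_sum] mu_inv] pi_stat r.
have [/andP[a0 a1] /andP[b0 b1]] := (a01, b01).
have [/andP[c0 c1] /andP[d0 d1]] := (c01, d01).
have [/andP[t10 t11] /andP[t20 t21]] := (t101, t201).
have s1 : 0 < 1 - theta1 by rewrite subr_gt0.
have s2 : 0 < 1 - theta2 by rewrite subr_gt0.
have bd0 : 0 < 1 - b - d by rewrite -addrA -opprD subr_gt0.
have q0 : 0 < q by rewrite divr_gt0.
have al0 : 0 < alpha by rewrite divr_gt0 ?mulr_gt0.
have be0 : 0 < beta by rewrite divr_gt0 ?mulr_gt0.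
have ga0 : 0 < gamma by rewrite divr_gt0 ?mulr_gt0.
have de0 : 0 < delta by rewrite divr_gt0 ?mulr_gt0.
have r0 : 0 < r by rewrite divr_gt0.
split; first by rewrite r0 ltr_pdivrMr // mul1r ltrD2l ltrN2.
have nondeg' k : alpha * beta != gamma * delta * q ^+ k.
  apply/eqP => eq_ab; apply: (nondeg k).
  apply: (mulfI (lt0r_neq0 (mulr_gt0 ga0 de0))).
  rewrite -eq_ab /alpha /beta /gamma /delta; field.
  by rewrite !gt_eqF.
have [D [E [phi rep]]] :=
  asep_module_exists (lt0r_neq0 q0) (lt0r_neq0 ga0) nondeg'.
pose F := mp_weight D E 1 phi; pose f (s : config N) := F (word s).
pose g (s : config N) := r ^+ count id (word s) * f s.
pose s0 := empty_config N.
pose L := generator (asep_rate (N := N) q alpha beta gamma delta).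
pose K : config N -> config N -> R :=
  six_vertex_chain a b c d theta1 theta2 (horizontal_path N y).
have fL s' : \sum_s f s * L s s' = 0.
  rewrite /L balance_generator.
  exact: (asep_balance (mp_bulk rep) (mp_left rep) (mp_right rep)).
have gK s' : \sum_s g s * K s s' = g s'.
  under eq_bigr => s _ do rewrite /K six_vertex_chain_word //.
  rewrite /g /f (sum_config N (fun w => r ^+ count id w * F w
    * word_kernel a b c d theta1 theta2 w (word s'))).
  rewrite -[X in words X](size_word s').
  by apply: (kernel_invariance _ _ _ rep); rewrite ?size_word ?gt_eqF.
have piL : forall s', \sum_s pi s * L s s' = 0.
  apply: semigroup_invariant_balance => t s' t0.
  by have [_] := pi_stat t t0; apply.
have [[pi_ge0 pi_sum] _] := pi_stat 0 (lexx 0).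
have L_eq0 := asep_balanced_eq0 N0 q0 al0 be0 ga0 de0.
have K_eq0 := six_vertex_balanced_eq0 N0 (y := y) a01 b01 c01 d01 t101 t201.
have muK := invariant_balanced mu_inv.
have mu_g := balanced_proportional K_eq0 muK (invariant_balanced gK).
have pi_f := balanced_proportional L_eq0 piL fL.
have f0 : f s0 != 0.
  apply/eqP => /(L_eq0 f fL) f_eq0.
  apply: (mp_nonzero rep (n := N)) => s szs.
  by have [tau <-] := config_of_word szs; exact: f_eq0.
have p_gt0 (p : config N -> R) : (forall s, 0 <= p s) -> \sum_s p s = 1 ->
    (p s0 = 0 -> forall s, p s = 0) -> 0 < p s0.
  move=> p_ge0 p_sum p_eq0; rewrite lt_neqAle p_ge0 andbT eq_sym.
  apply/eqP => /p_eq0 p0; move: p_sum; rewrite big1 // => /eqP.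
  by rewrite eq_sym oner_eq0.
have mu0 : 0 < mu s0 := p_gt0 mu mu_ge0 mu_sum (K_eq0 mu muK).
have pi0 : 0 < pi s0 := p_gt0 pi pi_ge0 pi_sum (L_eq0 pi piL).
(* at the empty configuration r^|s| is 1, which fixes Z *)
exists (pi s0 / mu s0); split; first exact: divr_gt0.
move=> tau; rewrite sum_config_count.
have g0 : g s0 = f s0.
  by rewrite /g word_empty_config count_nseq /= mul0n mul1r.
apply: (mulIf f0); rewrite -[in LHS]g0 mu_g /g.
have -> : f tau = pi tau * f s0 / pi s0 by rewrite pi_f mulfK ?gt_eqF.
by field; rewrite !gt_eqF.
Qed.
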